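(* Let $C>0$ be a fixed constant. There exist positive constants $C_1,C_2$ (depending only on $C$) such that the following holds. Let $n,k,n_0$ be integers with $2\le k\le n$, $2\le n_0\le n$, $\mathcal Z_{n,k,n_0}\neq\emptyset$ and $n_0\ge Cn/k$. In the network sequence model with probability matrix $\boldsymbol\Theta_0$ satisfying $\|\boldsymbol\Theta_0\|_\infty\ge \frac{k\log k}{n}$, the least squares estimator $\widehat{\boldsymbol\Theta}$ over $\mathcal Z_{n,k,n_0}$ satisfies $$\mathbb E\left[\frac{1}{n^{2}}\|\widehat{\boldsymbol\Theta}-\boldsymbol\Theta_0\|_F^2\right]\le \frac{C_1}{n^{2}}\|\boldsymbol\Theta_0-\boldsymbol\Theta_{*,n_0}\|_F^2+C_2\|\boldsymbol\Theta_0\|_\infty\left(\frac{\log k}{n}+\frac{k^2}{n^2}\right).$$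
   Context: Network sequence model: $\boldsymbol\Theta_0$ is a fixed symmetric $n\times n$ matrix with entries in $[0,1]$ and zero diagonal. One observes $\boldsymbol A'=(\boldsymbol A_{ij},\,1\le j<i\le n)$, independent Bernoulli variables with $\mathbb P(\boldsymbol A_{ij}=1)=(\boldsymbol\Theta_0)_{ij}$; $\mathbb E$ is expectation with respect to their distribution. $[m]=\{1,\dots,m\}$. $\mathcal Z_{n,k,n_0}$ is the set of maps $z:[n]\to[k]$ with $\min_{a\in[k]}|z^{-1}(a)|\ge n_0$. $\mathbb R^{k\times k}_{\rm sym}$ is the set of real symmetric $k\times k$ matrices. $\|\cdot\|_F$ is the Frobenius norm and $\|\cdot\|_\infty$ the entrywise supremum norm. Least squares estimator: let $L(\boldsymbol Q,z)=\sum_{1\le j<i\le n}(\boldsymbol A_{ij}-\boldsymbol Q_{z(i)z(j)})^2$ and let $(\widehat{\boldsymbol Q},\hat z)$ be a minimizer of $L(\boldsymbol Q,z)$ over $\boldsymbol Q\in\mathbb R^{k\times k}_{\rm sym}$, $z\in\mathcal Z_{n,k,n_0}$. Then $\widehat{\boldsymbol\Theta}$ is the symmetric $n\times n$ matrix with zero diagonal and $\widehat{\boldsymbol\Theta}_{ij}=\widehat{\boldsymbol Q}_{\hat z(i)\hat z(j)}$ for $i>j$. $\boldsymbol\Theta_{*,n_0}$ is a best Frobenius-norm approximation of $\boldsymbol\Theta_0$ in $\mathcal T_{n_0}[k]=\{\boldsymbol\Theta:\ \exists z\in\mathcal Z_{n,k,n_0},\ \boldsymbol Q\in\mathbb R^{k\times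 k}_{\rm sym}$ with $\boldsymbol\Theta_{ij}=\boldsymbol Q_{z(i)z(j)}$ for $i\ne j$ and $\boldsymbol\Theta_{ii}=0$ for all $i\}$. *)

(* Defs.v *)
From mathcomp Require Import all_boot all_order all_algebra.
From mathcomp Require Import reals topology normedtype exp probability.

Set Implicit Arguments.
Unset Strict Implicit.
Unset Printing Implicit Defensive.

Import Order.TTheory GRing.Theory Num.Theory numFieldNormedType.Exports.

Local Open Scope ring_scope.

(* Index set of the observations: pairs (i, j) with j < i. *)
Notation dyad n := {p : 'I_n * 'I_n | (p.2 < p.1)%N}.

(* A realization of the lower triangle A' = (A_ij, j < i). *)
Notation network n := {ffun dyad n -> bool}.

Definition probability_matrix (R : realType) (n : nat) (Theta : 'M[R]_n) :=
  [/\ Theta^T = Theta,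
      forall i j, 0 <= Theta i j <= 1 &
      forall i, Theta i i = 0].

(* Probability of the realization A when the entries A_ij are independent
   Bernoulli variables with means Theta_ij. *)
Definition network_pmf (R : realType) (n : nat) (Theta : 'M[R]_n)
    (A : network n) : R :=
  \prod_(p : dyad n) bernoulli_pmf (Theta (val p).1 (val p).2) (A p).

Definition network_expectation (R : realType) (n : nat) (Theta : 'M[R]_n)
    (X : network n -> R) : R :=
  \sum_(A : network n) network_pmf Theta A * X A.

Definition frobenius_norm (R : realType) (m n : nat) (M : 'M[R]_(m, n)) : R :=
  Num.sqrt (\sum_i \sum_j M i j ^+ 2).

(* The label maps z : [n] -> [k] all of whose classes have at least n0
   elements. *)
Definition balanced (n k n0 : nat) (z : {ffun 'I_n -> 'I_k}) :=
  forall a : 'I_k, (n0 <= #|[pred i | z i == a]|)%N.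

(* For symmetric Q this is the symmetric matrix with zero diagonal determined
   by its entries Q_{z(i)z(j)}, i > j. *)
Definition block_model (R : realType) (n k : nat) (Q : 'M[R]_k)
    (z : {ffun 'I_n -> 'I_k}) : 'M[R]_n :=
  \matrix_(i, j) (if i == j then 0 else Q (z i) (z j)).

Definition ls_criterion (R : realType) (n k : nat) (A : network n)
    (Q : 'M[R]_k) (z : {ffun 'I_n -> 'I_k}) : R :=
  \sum_(p : dyad n) ((A p)%:R - Q (z (val p).1) (z (val p).2)) ^+ 2.

Definition ls_minimizer (R : realType) (n k n0 : nat) (A : network n)
    (Qhat : 'M[R]_k) (zhat : {ffun 'I_n -> 'I_k}) :=
  [/\ Qhat^T = Qhat, balanced n0 zhat &
      forall (Q : 'M[R]_k) (z : {ffun 'I_n -> 'I_k}),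
        Q^T = Q -> balanced n0 z ->
        ls_criterion A Qhat zhat <= ls_criterion A Q z].

(* Minimizers need not be unique: any selection of one for each realization
   of the data yields a least squares estimator. *)
Definition least_squares_estimator (R : realType) (n k n0 : nat)
    (Thetahat : network n -> 'M[R]_n) :=
  forall A : network n,
    exists (Qhat : 'M[R]_k) (zhat : {ffun 'I_n -> 'I_k}),
      ls_minimizer n0 A Qhat zhat /\ Thetahat A = block_model Qhat zhat.

Definition block_model_class (R : realType) (n k n0 : nat) (Theta : 'M[R]_n) :=
  exists (z : {ffun 'I_n -> 'I_k}) (Q : 'M[R]_k),
    [/\ balanced n0 z, Q^T = Q & Theta = block_model Q z].

Definition best_approximation (R : realType) (n k n0 : nat)
    (Theta0 Thetastar : 'M[R]_n) :=
  block_model_class k n0 Thetastar /\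
  forall Theta : 'M[R]_n, block_model_class k n0 Theta ->
    frobenius_norm (Theta0 - Thetastar) <= frobenius_norm (Theta0 - Theta).

(* Main.v *)
Require Import Defs.
From mathcomp Require Import all_boot all_order all_algebra.
From mathcomp Require Import boolp reals topology sequences normedtype exp.
From mathcomp Require Import probability ring lra.

Set Implicit Arguments.
Unset Strict Implicit.
Unset Printing Implicit Defensive.

Import Order.TTheory GRing.Theory Num.Theory numFieldNormedType.Exports.

Local Open Scope ring_scope.

(** Write [th] for the vector of means on the dyads, [e] for the centered noise,
    [rho] for the sup norm of the means, and [P z] for the averaging over the
    blocks of a label map [z], which is an orthogonal projection.

    The least squares estimator is [P zhat (th + e)], so its squared error is
    the squared bias of [zhat] plus [|P zhat e|^2].  Comparing the criterion at
    the estimator and at the best approximation bounds the squared bias by the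
    approximation error, a centered term, a linear form of the noise in the
    direction [P zhat th - th], and [|P zhat e|^2] again
    ([least_squares_error_le]).  It remains to control two suprema over the
    [k ^ n] label maps.

    Both come from a single estimate ([noise_mgf_le]): a linear form of the
    noise with coefficients bounded by [1] is sub-Gaussian with variance proxy
    of order [rho].  The bias direction has entries bounded by [rho], so the
    linear form can be scaled by a multiple of [1 / rho]; the squared bias
    absorbs its variance, and the union over the label maps costs
    [rho * n * ln k] ([mean_penalized_noise_le]).

    The quadratic term [|P z e|^2] is the sum over the blocks of
    [S ^ 2 / N], for a block of [N] dyads with noise sum [S].  Sparsity is the
    obstacle: the exponential moments of [S ^ 2 / (rho * N)] are bounded only
    as long as [S] is at most of order [rho * N].  In this range the exponential
    of the square is dominated by a finite sum of exponentials of linear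
    functions of [S] ([expR_square_le_majorant]), which reduces the product
    over the blocks to the linear case and costs
    [rho * (n * ln k + k ^ 2)] ([mean_projected_noise_le]).

    Outside of this range, some pair of vertex sets of size at least [n0] has
    too many edges.  The union bound over all pairs of sets wins because
    [n0 >= C * n / k] and [rho >= k * ln k / n] give [rho * n0 >= C * ln k]:
    each vertex of a set brings a factor which is a large negative power of
    [k], and only the sets with at least [n0] vertices count
    ([mean_excess_le], [sum_large_sets_le]).  The probability is then smaller
    than [n ^ -2] ([mul_large_sets_bound_le1]), which offsets the trivial bound
    [n ^ 2] of the quadratic term. *)

(** * Elementary inequalities *)

Lemma ln2_ge_half (R : realType) : 2^-1 <= ln (2 : R).
Proof.
rewrite -ler_expR lnK ?posrE//.
have h := expR_ge1Dx (- 2^-1 : R).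
have hm : expR (2^-1 : R) * expR (- 2^-1) = 1 by exact: expRxMexpNx_1.
have := expR_gt0 (2^-1 : R); nra.
Qed.

(** Squaring [1 + y <= expR y] at [y = - x / 2] gives
    [expR x <= (1 - x / 2) ^- 2]; the constant [2] makes the comparison with
    this bound tight at [x = 1]. *)
Lemma expR_le_quadratic (R : realType) (x : R) :
  `|x| <= 1 -> expR x <= 1 + x + 2 * x ^+ 2.
Proof.
rewrite ler_norml => /andP[x_ge x_le].
have h := expR_ge1Dx (- (x / 2)).
have e2 : expR x * expR (- (x / 2)) ^+ 2 = 1.
  by rewrite expr2 -!expRD (_ : x + _ = 0) ?expR0//; lra.
set y := expR (- (x / 2)) in h e2.
have hy : (1 - x / 2) ^+ 2 <= y ^+ 2 by nra.
have y0 : 0 < y ^+ 2 by rewrite exprn_gt0// expR_gt0.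
rewrite -(ler_pM2r y0) e2.
have q0 : 0 <= 1 + x + 2 * x ^+ 2 by nra.
apply: le_trans (ler_wpM2l q0 hy).
have -> : (1 + x + 2 * x ^+ 2) * (1 - x / 2) ^+ 2
  = 1 + x ^+ 2 * ((1 - x) * (5 / 4 - x / 2)) by field.
by rewrite lerDl mulr_ge0 ?sqr_ge0// mulr_ge0//; lra.
Qed.

(** * Independent Bernoulli variables *)

Section IndependentBernoulli.
Variables (R : realType) (T : finType) (theta : T -> R) (rho : R).
Hypothesis theta01 : forall p, 0 <= theta p <= 1.
Hypothesis theta_le : forall p, theta p <= rho.

Implicit Types (A : {ffun T -> bool}) (X Y : {ffun T -> bool} -> R).

Definition bernoulli_weight A : R := \prod_p bernoulli_pmf (theta p) (A p).

Definition mean X : R := \sum_A bernoulli_weight A * X A.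

Definition noise A (p : T) : R := (A p)%:R - theta p.

Lemma eq_mean X Y : X =1 Y -> mean X = mean Y.
Proof. by move=> e; apply: eq_bigr => A _; rewrite e. Qed.

Lemma bernoulli_weight_ge0 A : 0 <= bernoulli_weight A.
Proof.
apply: prodr_ge0 => p _; rewrite /bernoulli_pmf.
by case: (A p); have := theta01 p; lra.
Qed.

Lemma le_mean X Y :
  (forall A, X A <= Y A) -> mean X <= mean Y.
Proof.
by move=> h; apply: ler_sum => A _; rewrite ler_wpM2l// bernoulli_weight_ge0.
Qed.

Lemma meanD X Y :
  mean (fun A => X A + Y A) = mean X + mean Y.
Proof. by rewrite -big_split; apply: eq_bigr => A _; rewrite mulrDr. Qed.

Lemma meanZ c X : mean (fun A => c * X A) = c * mean X.
Proof. by rewrite mulr_sumr; apply: eq_bigr => A _; rewrite mulrCA. Qed.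

Lemma mean_sum (I : finType) (P : pred I)
    (X : I -> {ffun T -> bool} -> R) :
  mean (fun A => \sum_(i | P i) X i A) = \sum_(i | P i) mean (X i).
Proof.
by rewrite exchange_big; apply: eq_bigr => A _; rewrite mulr_sumr.
Qed.

(** Independence of the coordinates, by exchanging the product with the sum over
    the realizations. *)
Lemma mean_prod (g : T -> bool -> R) :
  mean (fun A => \prod_p g p (A p))
  = \prod_p (theta p * g p true + (1 - theta p) * g p false).
Proof.
rewrite /mean /bernoulli_weight.
rewrite (eq_bigr _ (fun A _ => esym (big_split _ _ _ _ _))) /=.
rewrite -(bigA_distr_bigA (fun p b => bernoulli_pmf (theta p) b * g p b)).
by apply: eq_bigr => p _; rewrite big_bool.
Qed.

Lemma mean_cst c : mean (fun=> c) = c.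
Proof.
transitivity (c * mean (fun A => \prod_(p : T) 1)).
  rewrite -meanZ; apply: eq_mean => A.
  by rewrite big1 ?mulr1.
rewrite (mean_prod (fun _ _ => 1)) big1 ?mulr1// => p _; lra.
Qed.

Lemma mean_noise p : mean (noise ^~ p) = 0.
Proof.
pose g q b : R := if q == p then b%:R - theta p else 1.
transitivity (mean (fun A => \prod_q g q (A q))).
  apply: eq_mean => A; rewrite (bigD1 p)//= {1}/g eqxx.
  by rewrite big1 ?mulr1// => q /negPf qp; rewrite /g qp.
rewrite (mean_prod g) (bigD1 p)//= /g eqxx.
by rewrite [X in X * _](_ : _ = 0) ?mul0r//=; ring.
Qed.

Lemma mean_dot_noise (w : T -> R) :
  mean (fun A => \sum_p w p * noise A p) = 0.
Proof.
rewrite mean_sum big1// => p _.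
by rewrite meanZ mean_noise mulr0.
Qed.

Lemma bernoulli_mgf_le (x t : R) : `|x| <= 1 -> 0 <= t <= 1 -> t <= rho ->
  t * expR (x * (1 - t)) + (1 - t) * expR (x * (0 - t))
  <= expR (2 * rho * x ^+ 2).
Proof.
move=> x1 /andP[t0 t1] trho.
have small y : `|y| <= 1 -> `|x * y| <= 1.
  by move=> y1; rewrite normrM mulr_ile1.
have [b1 b0] : `|1 - t| <= 1 /\ `|0 - t| <= 1 by rewrite !ler_norml; lra.
have h1 := expR_le_quadratic (small _ b1).
have h0 := expR_le_quadratic (small _ b0).
apply: le_trans (expR_ge1Dx _).
have t1' : 0 <= 1 - t by lra.
apply: le_trans (lerD (ler_wpM2l t0 h1) (ler_wpM2l t1' h0)) _.
have xx0 : 0 <= x ^+ 2 by exact: sqr_ge0.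
have var_le : t * (1 - t) <= rho by nra.
have := ler_wpM2r xx0 var_le; nra.
Qed.

(** The bound on the coefficients keeps every exponent in the range where the
    exponential is quadratic, so that only the variances, which are at most
    [rho], enter. *)
Lemma noise_mgf_le (x : T -> R) : (forall p, `|x p| <= 1) ->
  mean (fun A => expR (\sum_p x p * noise A p))
  <= expR (2 * rho * \sum_p x p ^+ 2).
Proof.
move=> x1; under eq_mean do rewrite expR_sum.
rewrite (mean_prod (fun p b => expR (x p * (b%:R - theta p)))).
rewrite mulr_sumr expR_sum; apply: ler_prod => p _.
rewrite bernoulli_mgf_le ?andbT//.
by have := theta01 p => /andP[t0 t1]; rewrite addr_ge0 ?mulr_ge0 ?expR_ge0//; lra.
Qed.

(** A convexity-free form of Jensen's inequality: [expR y <= F] gives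
    [y <= ln M - 1 + F / M] for every [M > 0], and the right-hand side is
    linear in [F].  The random index costs a union over all the indices. *)
Lemma mean_max_le (Z : finType) (zhat : {ffun T -> bool} -> Z)
    (W : {ffun T -> bool} -> R) (F : Z -> {ffun T -> bool} -> R) (c : R) :
  0 < c -> (forall z A, 0 <= F z A) ->
  (forall A, expR (W A) <= F (zhat A) A) ->
  (forall z, mean (F z) <= c) ->
  mean W <= ln (#|Z|%:R * c).
Proof.
move=> c0 F0 WF EF.
have Z0 : (0 : R) < #|Z|%:R.
  by rewrite ltr0n; apply/card_gt0P; exists (zhat [ffun=> false]).
set M := #|Z|%:R * c.
have M0 : 0 < M by rewrite mulr_gt0.
apply: (@le_trans _ _ (mean (fun A => (ln M - 1) + M^-1 * \sum_z F z A))).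
  apply: le_mean => A.
  have : 1 + (W A - ln M) <= expR (W A - ln M) by exact: expR_ge1Dx.
  rewrite expRB lnK ?posrE//.
  have : expR (W A) <= \sum_z F z A.
    by rewrite (bigD1 (zhat A))//= ler_wpDr ?WF ?sumr_ge0.
  rewrite -(ler_pM2l (_ : 0 < M^-1)) ?invr_gt0// [expR (W A) / _]mulrC.
  lra.
rewrite meanD mean_cst meanZ mean_sum.
have : \sum_z mean (F z) <= M.
  rewrite /M -sum1_card natr_sum mulr_suml; apply: ler_sum => z _.
  by rewrite mul1r.
rewrite -(ler_pM2l (_ : 0 < M^-1)) ?invr_gt0// mulVf ?gt_eqF//.
lra.
Qed.

End IndependentBernoulli.

(** * Block averages *)

Section BlockAverages.
Variables (R : realType) (T : finType).
Implicit Types u v w : T -> R.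

Definition dot u v : R := \sum_p u p * v p.
Definition nsq u : R := \sum_p u p ^+ 2.

Lemma nsq_ge0 u : 0 <= nsq u.
Proof. by apply: sumr_ge0 => p _; exact: sqr_ge0. Qed.

Lemma nsqB u v : nsq (fun p => u p - v p) = nsq u - 2 * dot u v + nsq v.
Proof.
rewrite /nsq /dot mulr_sumr -sumrB -big_split; apply: eq_bigr => p _ /=; ring.
Qed.

Lemma nsqD u v : nsq (fun p => u p + v p) = nsq u + 2 * dot u v + nsq v.
Proof.
rewrite /nsq /dot mulr_sumr -!big_split; apply: eq_bigr => p _ /=; ring.
Qed.

Lemma dotBr u v w : dot u (fun p => v p - w p) = dot u v - dot u w.
Proof. by rewrite /dot -sumrB; apply: eq_bigr => p _; rewrite mulrBr. Qed.

Lemma dotBl u v w : dot (fun p => u p - v p) w = dot u w - dot v w.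
Proof. by rewrite /dot -sumrB; apply: eq_bigr => p _; rewrite mulrBl. Qed.

Variables (B : finType) (beta : T -> B).

Definition bsize (b : B) : R := #|[pred p | beta p == b]|%:R.
Definition bsum v (b : B) : R := \sum_(p | beta p == b) v p.
Definition bavg v (p : T) : R := bsum v (beta p) / bsize (beta p).

Lemma bsize_ge0 b : 0 <= bsize b. Proof. exact: ler0n. Qed.

Lemma bsize_gt0 p : 0 < bsize (beta p).
Proof. by rewrite ltr0n; apply/card_gt0P; exists p; rewrite inE. Qed.

Lemma bsum_cst c b : \sum_(p | beta p == b) c = bsize b * c.
Proof. by rewrite sumr_const mulr_natl. Qed.

Lemma bsum_eq0 v b : bsize b = 0 -> bsum v b = 0.
Proof.
move=> /eqP; rewrite pnatr_eq0 => /eqP/card0_eq e.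
by rewrite /bsum big_pred0// => p; have := e p; rewrite inE.
Qed.

Lemma dot_blockwise v (g : B -> R) :
  dot v (fun p => g (beta p)) = \sum_b bsum v b * g b.
Proof.
rewrite /dot (partition_big beta predT)//; apply: eq_bigr => b _.
by rewrite mulr_suml; apply: eq_bigr => p /eqP ->.
Qed.

(** Block averaging is the orthogonal projection onto the functions that are
    constant on the blocks. *)
Lemma dot_bavgB v (g : B -> R) :
  dot (fun p => v p - bavg v p) (fun p => g (beta p)) = 0.
Proof.
rewrite dotBl !dot_blockwise -sumrB big1// => b _; rewrite -mulrBl.
have -> : bsum (bavg v) b = bsize b * (bsum v b / bsize b).
  by rewrite -bsum_cst; apply: eq_bigr => p /eqP e; rewrite /bavg e.
have [b0|b0] := eqVneq (bsize b) 0; first by rewrite (bsum_eq0 _ b0) b0; ring.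
by rewrite [bsize b * _]mulrC divfK// subrr mul0r.
Qed.

Lemma nsq_bavgB v : nsq (fun p => v p - bavg v p) = nsq v - nsq (bavg v).
Proof.
have := dot_bavgB v (fun b => bsum v b / bsize b).
rewrite -/(bavg v) nsqB dotBl => /eqP; rewrite subr_eq0 => /eqP ->.
have -> : dot (bavg v) (bavg v) = nsq (bavg v) by [].
ring.
Qed.

Lemma nsq_bavg_le v : nsq (bavg v) <= nsq v.
Proof. by rewrite -subr_ge0 -nsq_bavgB nsq_ge0. Qed.

Lemma bavgB u v p : bavg (fun q => u q - v q) p = bavg u p - bavg v p.
Proof. by rewrite /bavg /bsum sumrB/= mulrBl. Qed.

Lemma nsq_bavg v : nsq (bavg v) = \sum_b bsum v b ^+ 2 / bsize b.
Proof.
rewrite /nsq (partition_big beta predT)//; apply: eq_bigr => b _.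
rewrite (eq_bigr (fun=> (bsum v b / bsize b) ^+ 2)); last first.
  by move=> p /eqP e; rewrite /bavg e.
rewrite bsum_cst; have [->|b0] := eqVneq (bsize b) 0; first by rewrite invr0; ring.
by field.
Qed.

Lemma bavg_itv v lo hi : (forall p, lo <= v p <= hi) ->
  forall p, lo <= bavg v p <= hi.
Proof.
move=> vb p; have b0 := bsize_gt0 p; rewrite /bavg.
rewrite ler_pdivlMr// ler_pdivrMr// ![_ * bsize _]mulrC -!bsum_cst.
by apply/andP; split; apply: ler_sum => q _; have /andP[] := vb q.
Qed.

(** Pythagoras: the squared distances to [v] differ by the squared distance
    between the two block-constant vectors. *)
Lemma bavg_unique v (g : B -> R) :
  nsq (fun p => v p - g (beta p)) <= nsq (fun p => v p - bavg v p) ->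
  forall p, g (beta p) = bavg v p.
Proof.
move=> le_g p.
pose d p := g (beta p) - bavg v p.
have dE : nsq (fun p => v p - g (beta p))
    = nsq (fun p => v p - bavg v p) + nsq d.
  transitivity (nsq (fun p => (v p - bavg v p) - d p)).
    by apply: eq_bigr => q _; rewrite /d; congr (_ ^+ 2); ring.
  rewrite nsqB (dot_bavgB v (fun b => g b - bsum v b / bsize b)); ring.
have /eqP : nsq d = 0 by apply/le_anti; rewrite nsq_ge0 andbT; lra.
rewrite psumr_eq0 => [/allP/(_ p)|q _]; last exact: sqr_ge0.
by rewrite mem_index_enum sqrf_eq0 subr_eq0 => /(_ isT)/eqP.
Qed.

(** Deterministic oracle inequality.  By orthogonality both sides of the
    hypothesis split into bias, projected noise and cross terms.  The cross term
    along the bias direction is not centered when the partition depends on [a],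
    so a quarter of the squared bias is set aside to control it; since this
    cross term comes with a factor [2], half of the squared bias remains, which
    is why the error of [t] is doubled. *)
Lemma least_squares_error_le a th t (e := fun p => a p - th p) :
  nsq (fun p => a p - bavg a p) <= nsq (fun p => a p - t p) ->
  nsq (fun p => bavg a p - th p)
  <= 2 * nsq (fun p => th p - t p) + 4 * dot (fun p => th p - t p) e
     + 4 * (dot (fun p => bavg th p - th p) e
            - nsq (fun p => bavg th p - th p) / 4)
     + 3 * nsq (bavg e).
Proof.
pose r p := bavg th p - th p.
pose f p := e p - bavg e p.
have r_perp : dot r (bavg e) = 0.
  have := dot_bavgB th (fun b => bsum e b / bsize b).
  rewrite -/(bavg e) => h; rewrite -[RHS]oppr0 -h /dot -sumrN.
  by apply: eq_bigr => p _; rewrite /r /bavg; ring.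
have -> : nsq (fun p => bavg a p - th p) = nsq r + nsq (bavg e).
  transitivity (nsq (fun p => r p + bavg e p)).
    by apply: eq_bigr => p _; rewrite bavgB /r; congr (_ ^+ 2); ring.
  rewrite nsqD r_perp; ring.
have -> : nsq (fun p => a p - bavg a p)
    = nsq r - 2 * dot r e + nsq e - nsq (bavg e).
  transitivity (nsq (fun p => r p - f p)).
    by apply: eq_bigr => p _; rewrite /f bavgB /r /e; ring.
  rewrite nsqB /f nsq_bavgB dotBr r_perp; ring.
have -> : nsq (fun p => a p - t p)
    = nsq (fun p => th p - t p) + 2 * dot (fun p => th p - t p) e + nsq e.
  by rewrite -nsqD; apply: eq_bigr => p _; rewrite /e; congr (_ ^+ 2); ring.
rewrite -/r; have := nsq_ge0 r; lra.
Qed.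

End BlockAverages.

(** * Exponential moments of the projected noise *)

Section SquareMajorant.
Variables (R : realType) (rho K : R) (M : nat).
Hypotheses (rho_ge0 : 0 <= rho) (K_ge8 : 8 <= K).

Local Notation grid := ('I_M * bool)%type.

(** The slope is truncated at [1] so that the moment generating function bound
    applies to every term of the grid, whatever the size [N] of the block. *)
Definition grid_slope (N : R) (j : grid) : R :=
  (-1) ^+ j.2 * Num.min 1 (j.1%:R / (K * Num.sqrt (rho * N))).

Definition grid_term (N s : R) (j : grid) : R :=
  expR (grid_slope N j * s - j.1%:R ^+ 2 / (2 * K)).

(** A discrete substitute for the Gaussian linearization, which writes the
    exponential of a square as an average of exponentials of linear functions.
    The boolean of a grid point is the sign of the slope. *)
Definition square_majorant (N s : R) : R :=
  expR 1 * \sum_(j : grid) grid_term N s j.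

Definition majorant_cst : R := expR 1 * (2 / (1 - expR (- (4 * K)^-1))).

Let K_gt0 : 0 < K. Proof. exact: lt_le_trans K_ge8. Qed.

Lemma square_majorant_ge0 N s : 0 <= square_majorant N s.
Proof. by rewrite mulr_ge0 ?expR_ge0// sumr_ge0// => j _; exact: expR_ge0. Qed.

Lemma le_square_majorant N s j : expR 1 * grid_term N s j <= square_majorant N s.
Proof.
rewrite ler_wpM2l ?expR_ge0// (bigD1 j)//= lerDl.
by apply: sumr_ge0 => i _; exact: expR_ge0.
Qed.

Lemma square_majorant_ge1 N s : (0 < M)%N -> 1 <= square_majorant N s.
Proof.
move=> M0; apply: le_trans (le_square_majorant N s (Ordinal M0, false)).
rewrite /grid_term /grid_slope/= mul0r min_r ?ler01// mulr0 mul0r expr0n/=.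
by rewrite mul0r subr0 expR0 mulr1 ltW// expR_gt1.
Qed.

Lemma grid_slope_le1 N j : `|grid_slope N j| <= 1.
Proof.
rewrite normrM normr_sign mul1r ger0_norm ?ge_min ?lexx//.
by rewrite le_min ler01/= divr_ge0// mulr_ge0 ?sqrtr_ge0// ltW.
Qed.

(** The variance of a term of the grid uses up half of its Gaussian weight
    [expR (- m ^ 2 / (2 * K))]; this is where [8 <= K] matters. *)
Lemma grid_slope_sqr_le N j : 0 <= N ->
  2 * rho * (N * grid_slope N j ^+ 2) <= j.1%:R ^+ 2 / (4 * K).
Proof.
move=> N0; rewrite /grid_slope exprMn sqrr_sign mul1r.
set sg := Num.sqrt (rho * N); set m : R := j.1%:R.
have rN0 : 0 <= rho * N by rewrite mulr_ge0.
have sg2 : sg ^+ 2 = rho * N by rewrite sqr_sqrtr.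
have m0 : 0 <= m by exact: ler0n.
have [rN|rN] := eqVneq (rho * N) 0.
  rewrite mulrA -[2 * rho * N]mulrA rN mulr0 mul0r.
  by rewrite divr_ge0 ?sqr_ge0// mulr_ge0// ltW.
have sg0 : 0 < sg by rewrite sqrtr_gt0 lt_neqAle eq_sym rN rN0.
have h : Num.min 1 (m / (K * sg)) ^+ 2 <= (m / (K * sg)) ^+ 2.
  have r0 : 0 <= m / (K * sg) by rewrite divr_ge0// mulr_ge0// ltW.
  by rewrite lerXn2r ?nnegrE// ?le_min ?ler01//= ge_min lexx orbT.
rewrite [leLHS](_ : _ = (2 * (rho * N)) * Num.min 1 (m / (K * sg)) ^+ 2); last by ring.
apply: le_trans (ler_wpM2l _ h) _; first by rewrite mulr_ge0.
rewrite -sg2 [leLHS](_ : _ = (m ^+ 2 / (4 * K)) * (8 / K)); last first.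
  by field; rewrite !gt_eqF.
apply: ler_piMr; last by rewrite ler_pdivrMr// mul1r.
by rewrite divr_ge0 ?sqr_ge0// mulr_ge0// ltW.
Qed.

(** With [u = |s| / sqrt (rho * N)] and [m] the integer part of [u], the term
    of index [m] and of the sign of [s] has exponent at least
    [m ^ 2 / (2 * K)], which dominates [u ^ 2 / (4 * K)] up to [1].  The bound
    on [s] is what keeps the slope of this term at most [1]. *)
Lemma expR_square_le_majorant N s : 0 <= N -> (N = 0 -> s = 0) -> 0 < rho ->
  K * Num.sqrt (rho * N) < M%:R -> `|s| <= K * rho * N ->
  expR ((4 * K * rho)^-1 * (s ^+ 2 / N)) <= square_majorant N s.
Proof.
move=> N_ge0 s0 rho0 ltM sle.
have M0 : (0 < M)%N.
  rewrite -(ltr0n R); apply: le_lt_trans ltM.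
  by rewrite mulr_ge0 ?sqrtr_ge0// ltW.
have [N0|N0] := eqVneq N 0.
  by rewrite (s0 N0) expr0n/= mul0r mulr0 expR0 square_majorant_ge1.
have N_gt0 : 0 < N by rewrite lt_neqAle eq_sym N0.
set sg := Num.sqrt (rho * N) in ltM *.
have sg2 : sg ^+ 2 = rho * N by rewrite sqr_sqrtr// mulr_ge0.
have sg0 : 0 < sg by rewrite sqrtr_gt0 mulr_gt0.
set u := `|s| / sg.
have u0 : 0 <= u by rewrite divr_ge0// ltW.
have uK : u <= K * sg.
  by rewrite ler_pdivrMr// -mulrA -expr2 sg2 mulrA.
have /andP[mu um] := truncn_itv u0.
set m := Num.truncn u in mu um.
have mM : (m < M)%N by rewrite -(ltr_nat R); lra.
apply: le_trans (le_square_majorant N s (Ordinal mM, s < 0)).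
rewrite /grid_term /grid_slope/= -expRD ler_expR -/sg.
have -> : Num.min 1 (m%:R / (K * sg)) = m%:R / (K * sg).
  by rewrite min_r// ler_pdivrMr ?mulr_gt0// mul1r; lra.
rewrite [_ * s](_ : _ = m%:R * u / K); last first.
  rewrite /u normrEsign; set e : R := (-1) ^+ (s < 0)%R.
  by field; rewrite !gt_eqF.
have -> : (4 * K * rho)^-1 * (s ^+ 2 / N) = u ^+ 2 / (4 * K).
  rewrite /u expr_div_n sg2 real_normK ?num_real//; field.
  by rewrite !gt_eqF.
have m0 : (0 : R) <= m%:R by exact: ler0n.
have : 1 + (m%:R * u / K - m%:R ^+ 2 / (2 * K)) - u ^+ 2 / (4 * K)
   = (4 * K + 4 * m%:R * u - 2 * m%:R ^+ 2 - u ^+ 2) / (4 * K).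
  by field; rewrite gt_eqF.
set r : R := m%:R in mu um m0 *.
have um' : u <= r + 1 by rewrite -natr1 in um; exact: ltW.
suff : 0 <= (4 * K + 4 * r * u - 2 * r ^+ 2 - u ^+ 2) / (4 * K) by lra.
have K8 := K_ge8.
have d0 : 0 <= r * (u - r) by rewrite mulr_ge0 ?subr_ge0.
have d1 : 0 <= (u - r) * (1 - (u - r)) by rewrite mulr_ge0; lra.
by rewrite divr_ge0//; [nra|lra].
Qed.

(** Comparison with a geometric series makes the bound independent of the size
    of the grid. *)
Lemma sum_gauss_le : \sum_(j : grid) expR (- (j.1%:R ^+ 2 / (4 * K)))
  <= 2 / (1 - expR (- (4 * K)^-1)).
Proof.
rewrite -(pair_big xpredT xpredT
  (fun m (_ : bool) => expR (- ((m : 'I_M)%:R ^+ 2 / (4 * K))) : R))/=.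
set q := expR (- (4 * K)^-1).
have q1 : q < 1 by rewrite expR_lt1 oppr_lt0 invr_gt0 mulr_gt0.
have q0 : 0 <= q by exact: expR_ge0.
apply: (@le_trans _ _ (2 * \sum_(m < M) q ^+ m)).
  rewrite mulr_sumr; apply: ler_sum => m _.
  rewrite sumr_const card_bool -[leLHS]mulr_natl ler_wpM2l//.
  rewrite /q -expRM_natr ler_expR mulNr lerN2 mulrC ler_wpM2r//.
    by rewrite invr_ge0 mulr_ge0// ltW.
  rewrite -natrX ler_nat; case: (nat_of_ord m) => // i; exact: leq_pmulr.
rewrite ler_wpM2l// -[(1 - q)^-1]mul1r ler_pdivlMr; last by lra.
have := subrX1 q M; have := exprn_ge0 M q0; lra.
Qed.

Lemma majorant_cst_ge1 : 1 <= majorant_cst.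
Proof.
have e1 : 1 <= expR 1 :> R by rewrite ltW// expR_gt1.
have q1 : expR (- (4 * K)^-1) < 1 by rewrite expR_lt1 oppr_lt0 invr_gt0 mulr_gt0.
have q0 : 0 < expR (- (4 * K)^-1) by exact: expR_gt0.
rewrite -[1]mulr1 ler_pM// ler_pdivlMr; lra.
Qed.

Variables (T B : finType) (theta : T -> R) (beta : T -> B).
Hypothesis theta01 : forall p, 0 <= theta p <= 1.
Hypothesis theta_le : forall p, theta p <= rho.

(** Multiplying out the product over the blocks leaves exponentials of linear
    forms of the noise, whose slopes are constant on the blocks. *)
Lemma mean_prod_majorant_le :
  mean theta (fun A =>
    \prod_b square_majorant (bsize R beta b) (bsum beta (noise theta A) b))
  <= majorant_cst ^+ #|B|.
Proof.
set N := bsize R beta.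
have N0 b : 0 <= N b by exact: bsize_ge0.
pose sq (b : B) (j : grid) : R := expR (- (j.1%:R ^+ 2 / (4 * K))).
rewrite (@eq_mean _ _ _ _ (fun A => expR 1 ^+ #|B| *
    \sum_(g : {ffun B -> grid})
      \prod_b grid_term (N b) (bsum beta (noise theta A) b) (g b))); last first.
  by move=> A; rewrite big_split prodr_const bigA_distr_bigA.
rewrite meanZ exprMn ler_wpM2l ?exprn_ge0 ?expR_ge0//.
rewrite mean_sum.
apply: (@le_trans _ _ (\prod_b \sum_(j : grid) sq b j)); last first.
  rewrite -prodr_const; apply: ler_prod => b _; rewrite sum_gauss_le andbT.
  by apply: sumr_ge0 => j _; exact: expR_ge0.
rewrite bigA_distr_bigA; apply: ler_sum => g _.
pose c b := grid_slope (N b) (g b).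
pose m2 b : R := (g b).1%:R ^+ 2.
rewrite (@eq_mean _ _ _ _ (fun A => expR (- \sum_b m2 b / (2 * K)) *
    expR (\sum_p c (beta p) * noise theta A p))); last first.
  move=> A; rewrite -expR_sum -expRD; congr expR.
  rewrite sumrB addrC; congr (_ + _).
  transitivity (dot (noise theta A) (fun p => c (beta p))).
    by rewrite dot_blockwise; apply: eq_bigr => b _; rewrite mulrC.
  by apply: eq_bigr => p _; rewrite mulrC.
rewrite meanZ.
apply: le_trans (ler_wpM2l (expR_ge0 _)
  (noise_mgf_le theta01 theta_le (fun p => grid_slope_le1 _ _))) _.
rewrite -expRD -expR_sum ler_expR.
have -> : \sum_p c (beta p) ^+ 2 = \sum_b N b * c b ^+ 2.
  transitivity (dot (fun=> 1) (fun p => c (beta p) ^+ 2)).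
    by apply: eq_bigr => p _; rewrite mul1r.
  rewrite (dot_blockwise beta (fun=> 1) (fun b => c b ^+ 2)).
  by apply: eq_bigr => b _; rewrite /bsum bsum_cst mulr1.
rewrite -sumrN mulr_sumr -big_split; apply: ler_sum => b _ /=.
have h : 2 * rho * (N b * c b ^+ 2) <= m2 b / (4 * K) := grid_slope_sqr_le _ (N0 b).
have -> : m2 b / (2 * K) = m2 b / (4 * K) + m2 b / (4 * K).
  by field; rewrite gt_eqF.
rewrite -/(m2 b); lra.
Qed.

End SquareMajorant.

(** * Oracle inequality for block least squares *)

Section LeastSquares.
Variables (R : realType) (T B Z : finType) (theta : T -> R) (rho K : R).
Hypothesis theta01 : forall p, 0 <= theta p <= 1.
Hypothesis theta_le : forall p, theta p <= rho.
Hypotheses (rho_gt0 : 0 < rho) (K_ge8 : 8 <= K).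
Variables (beta : Z -> T -> B) (zhat : {ffun T -> bool} -> Z).

Local Notation e := (noise theta).
Local Notation bias z := (fun p => bavg (beta z) theta p - theta p).

Lemma bias_le z p : `|bavg (beta z) theta p - theta p| <= rho.
Proof.
have theta_itv q : 0 <= theta q <= rho.
  by rewrite theta_le andbT; have /andP[] := theta01 q.
have /andP[p0 pr] := theta_itv p.
have /andP[a0 ar] := bavg_itv (beta z) theta_itv p.
by rewrite ler_norml; lra.
Qed.

(** The penalty by the squared bias compensates exactly the variance proxy. *)
Lemma mean_penalized_noise_le :
  mean theta (fun A =>
    dot (bias (zhat A)) (e A) - nsq (bias (zhat A)) / 4)
  <= 8 * rho * ln #|Z|%:R.
Proof.
pose l := (8 * rho)^-1.
have l0 : 0 < l by rewrite invr_gt0 mulr_gt0.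
pose X z A := l * (dot (bias z) (e A) - nsq (bias z) / 4).
have EX z : mean theta (fun A => expR (X z A)) <= 1.
  have -> : mean theta (fun A => expR (X z A)) =
      mean theta (fun A => expR (- (l * (nsq (bias z) / 4))) *
        expR (\sum_p (l * (bias z) p) * e A p)).
    apply: eq_mean => A; rewrite -expRD /X mulrBr addrC; congr (expR (_ + _)).
    by rewrite mulr_sumr; apply: eq_bigr => p _; rewrite mulrA.
  rewrite meanZ.
  apply: le_trans (ler_wpM2l (expR_ge0 _) (noise_mgf_le theta01 theta_le _)) _.
    move=> p; rewrite normrM gtr0_norm// /l ler_pdivrMl ?mulr_gt0// mulr1.
    by apply: le_trans (bias_le z p) _; rewrite ler_peMl ?ltW//; lra.
  rewrite -expRD -[leRHS]expR0 ler_expR.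
  have -> : \sum_p (l * (bias z) p) ^+ 2 = l ^+ 2 * nsq (bias z).
    by rewrite mulr_sumr; apply: eq_bigr => p _; rewrite exprMn.
  rewrite [leLHS](_ : _ = 0)// /l; field; rewrite gt_eqF//.
rewrite -ler_pdivrMl ?mulr_gt0// -/l -meanZ.
rewrite -[#|Z|%:R]mulr1.
apply: (mean_max_le theta01 (zhat := zhat)
  (F := fun z A => expR (X z A))) => // z A.
exact: expR_ge0.
Qed.

(** [U] stands for a nonnegative variable of small mean that is at least [1]
    whenever the selected partition has a block with a large noise sum. *)
Variable U : {ffun T -> bool} -> R.
Hypothesis U_ge0 : forall A, 0 <= U A.
Hypothesis U_ge1 : forall A,
  (forall b, bsum (beta (zhat A)) (e A) b
             <= K * rho * bsize R (beta (zhat A)) b) \/ 1 <= U A.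

Lemma nsq_noise_le A : nsq (e A) <= #|T|%:R.
Proof.
rewrite -sum1_card natr_sum; apply: ler_sum => p _.
rewrite /noise; have /andP[] := theta01 p.
by case: (A p) => /=; nra.
Qed.

Lemma bsum_noise_ge z A b : - (rho * bsize R (beta z) b) <= bsum (beta z) (e A) b.
Proof.
rewrite -mulNr mulrC -bsum_cst; apply: ler_sum => p _.
by rewrite /noise; have := theta_le p; have := ler0n R (A p); lra.
Qed.

(** Outside the event where some block sum of the noise is too large, the
    exponential of the projected noise is controlled block by block; on this
    event, the trivial bound is used. *)
Lemma mean_projected_noise_le :
  mean theta (fun A => nsq (bavg (beta (zhat A)) (e A)))
  <= 4 * K * rho * (ln #|Z|%:R + #|B|%:R * ln (majorant_cst K))
     + #|T|%:R * mean theta U.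
Proof.
have K0 : 0 < K by exact: lt_le_trans K_ge8.
pose l := (4 * K * rho)^-1.
have l0 : 0 < l by rewrite invr_gt0 !mulr_gt0.
pose M := (Num.truncn (K * Num.sqrt (rho * #|T|%:R))).+1.
pose good A := [forall b, bsum (beta (zhat A)) (e A) b
                          <= K * rho * bsize R (beta (zhat A)) b].
pose W A := if good A then l * nsq (bavg (beta (zhat A)) (e A)) else 0.
pose F z A := \prod_b square_majorant rho K M (bsize R (beta z) b)
                        (bsum (beta z) (e A) b).
have F0 z A : 0 <= F z A by apply: prodr_ge0 => b _; exact: square_majorant_ge0.
have C0 : 1 <= majorant_cst K by exact: majorant_cst_ge1.
have WF A : expR (W A) <= F (zhat A) A.
  rewrite /W; case: ifPn => [/forallP gA|_]; last first.
    rewrite expR0 -[leLHS](expr1n _ #|B|) -prodr_const; apply: ler_prod => b _.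
    by rewrite ler01 square_majorant_ge1.
  rewrite nsq_bavg mulr_sumr expR_sum; apply: ler_prod => b _.
  rewrite expR_ge0/=; apply: expR_square_le_majorant => //.
  - exact: ltW.
  - exact: bsum_eq0.
  - apply: le_lt_trans (truncnS_gt _); rewrite ler_pM2l// ler_wsqrtr//.
    by rewrite ler_pM2l// ler_nat max_card.
  - rewrite ler_norml gA andbT; apply: le_trans (bsum_noise_ge _ _ _).
    rewrite lerN2 ler_wpM2r ?bsize_ge0// ler_peMl// ltW//.
    by apply: lt_le_trans K_ge8; rewrite ltr1n.
have EW : mean theta W <= ln (#|Z|%:R * majorant_cst K ^+ #|B|).
  apply: (mean_max_le theta01 (zhat := zhat) (F := F)) => // [|z].
    by rewrite exprn_gt0//; lra.
  by apply: mean_prod_majorant_le => //; exact: ltW.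
have Z0 : (0 : R) < #|Z|%:R.
  by rewrite ltr0n; apply/card_gt0P; exists (zhat [ffun=> false]).
have Cg0 : 0 < majorant_cst K by lra.
rewrite lnM ?posrE ?exprn_gt0// lnXn// in EW.
apply: le_trans (_ : mean theta (fun A => l^-1 * W A + #|T|%:R * U A) <= _).
  apply: le_mean => // A; rewrite /W.
  case: ifPn => [_|bad].
    by rewrite mulKf ?gt_eqF// lerDl mulr_ge0.
  have U1 : 1 <= U A by case: (U_ge1 A) => // gA; case/negP: bad; apply/forallP.
  rewrite mulr0 add0r; apply: le_trans (nsq_bavg_le _ _) _.
  by apply: le_trans (nsq_noise_le A) _; rewrite ler_peMr.
rewrite meanD !meanZ invrK lerD2r.
by rewrite [#|B|%:R * _]mulr_natl ler_pM2l ?mulr_gt0.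
Qed.

(** The mean of [least_squares_error_le], whose term along [theta - t] is
    centered since [t] does not depend on the data. *)
Lemma mean_error_le (t : T -> R) :
  (forall A : {ffun T -> bool},
     nsq (fun p => (A p)%:R - bavg (beta (zhat A)) (fun q => (A q)%:R) p)
     <= nsq (fun p => (A p)%:R - t p)) ->
  mean theta (fun A =>
    nsq (fun p => bavg (beta (zhat A)) (fun q => (A q)%:R) p - theta p))
  <= 2 * nsq (fun p => theta p - t p) + 32 * rho * ln #|Z|%:R
     + 3 * (4 * K * rho * (ln #|Z|%:R + #|B|%:R * ln (majorant_cst K))
            + #|T|%:R * mean theta U).
Proof.
move=> ls.
apply: le_trans (le_mean theta01 (fun A => least_squares_error_le theta (ls A))) _.
rewrite !meanD mean_cst !meanZ mean_dot_noise//.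
have h1 := mean_penalized_noise_le.
have h2 := mean_projected_noise_le.
rewrite /noise in h1 h2 *; lra.
Qed.

End LeastSquares.

(** * Dyads *)

Section Dyads.
Variables (R : realType) (n : nat).

Lemma sum_offdiag (F : 'I_n * 'I_n -> R) :
  \sum_(q | q.1 != q.2) F q
  = \sum_(p : dyad n) (F (val p) + F ((val p).2, (val p).1)).
Proof.
have sum_dyad (G : 'I_n * 'I_n -> R) :
    \sum_(p : dyad n) G (val p) = \sum_(q : 'I_n * 'I_n | (q.2 < q.1)%N) G q.
  exact/esym/(big_sub [pred q : 'I_n * 'I_n | (q.2 < q.1)%N]).
rewrite big_split/= (sum_dyad (fun q => F q)).
rewrite (sum_dyad (fun q => F (q.2, q.1))).
rewrite (bigID (fun q : 'I_n * 'I_n => (q.2 < q.1)%N))/=; congr (_ + _).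
  by apply: eq_bigl => q; case: ltnP => lt_q; rewrite ?andbF// andbT;
     apply: contraL lt_q => /eqP ->; rewrite ltnn.
pose swap (q : 'I_n * 'I_n) := (q.2, q.1).
rewrite (reindex_inj (inv_inj (_ : involutive swap)))/=; last by case.
by apply: eq_bigl => q; rewrite -leqNgt leq_eqVlt eq_sym -(inj_eq val_inj)/=;
   case: ltngtP.
Qed.

Lemma card_dyad_le : (#|{: dyad n}| <= n ^ 2)%N.
Proof.
by rewrite card_sig (leq_trans (max_card _))// card_prod card_ord mulnn.
Qed.

(** Every dyad is counted twice in the Frobenius norm. *)
Lemma frobenius_norm_sqr (M : 'M[R]_n) :
  M^T = M -> (forall i, M i i = 0) ->
  frobenius_norm M ^+ 2 = 2 * nsq (fun p : dyad n => M (val p).1 (val p).2).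
Proof.
move=> Msym M0; rewrite sqr_sqrtr; last first.
  by do 2![apply: sumr_ge0 => ? _]; exact: sqr_ge0.
rewrite pair_big/= (bigID (fun q : 'I_n * 'I_n => q.1 != q.2))/=.
rewrite [X in _ + X]big1 ?addr0 => [|[i j]/= /negPn/eqP ->]; last first.
  by rewrite M0 expr0n.
rewrite (sum_offdiag (fun q => M q.1 q.2 ^+ 2)) mulr_sumr.
apply: eq_bigr => p _ /=; rewrite -[in M (val p).2 _]Msym mxE; ring.
Qed.

Definition dyads_between (S S' : {set 'I_n}) : pred (dyad n) :=
  fun p => ((val p).1 \in S) && ((val p).2 \in S')
           || ((val p).2 \in S) && ((val p).1 \in S').

(** Each dyad comes from at most two of the [#|S| * (#|S'| - 1)] or more pairs
    of distinct elements of [S] and [S'], which need not be disjoint. *)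
Lemma card_dyads_between_ge (S S' : {set 'I_n}) : (2 <= #|S'|)%N ->
  #|S|%:R * #|S'|%:R <= 4 * #|dyads_between S S'|%:R :> R.
Proof.
move=> S'2.
pose f (q : 'I_n * 'I_n) : R := ((q.1 \in S) && (q.2 \in S'))%:R.
have ub : \sum_(q | q.1 != q.2) f q <= 2 * #|dyads_between S S'|%:R.
  rewrite sum_offdiag -sum1_card natr_sum mulr_sumr big_mkcond/= [leRHS]big_mkcond/=.
  apply: ler_sum => p _; rewrite /f unfold_in /dyads_between /=.
  by do 2!case: (_ && _) => /=; lra.
have lb : #|S|%:R * (#|S'|%:R - 1) <= \sum_(q | q.1 != q.2) f q.
  rewrite -(pair_big_dep xpredT (fun i j => i != j)
    (fun i j => ((i \in S) && (j \in S'))%:R))/=.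
  rewrite (bigID (mem S))/= -[leLHS]addr0.
  apply: lerD; last by do 2!apply: sumr_ge0 => ? _; exact: ler0n.
  rewrite -sum1_card natr_sum mulr_suml; apply: ler_sum => i iS.
  rewrite mul1r (eq_bigr (fun j => (j \in S')%:R)) => [|j _]; last by rewrite iS.
  have : \sum_j (j \in S')%:R = #|S'|%:R :> R.
    by rewrite -sum1_card natr_sum [RHS]big_mkcond/=; apply: eq_bigr => j _; case: ifP.
  rewrite (bigD1 i)//= (eq_bigl (fun j => i != j)) => [<-|j]; last by rewrite eq_sym.
  rewrite -lerBrDr; by case: (i \in S') => /=; lra.
have : (2 : R) <= #|S'|%:R by rewrite ler_nat.
have : (0 : R) <= #|S|%:R by exact: ler0n.
nra.
Qed.

End Dyads.

(** * Blocks with too many edges *)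

Section BlockExcess.
Variables (R : realType) (n : nat).

(** Half of the exponent is spent on the minimal size [n0]; the other half makes
    the sum over all the sets a binomial expansion. *)
Lemma sum_large_sets_le (x : R) (n0 : nat) : 0 <= x -> x <= 1 ->
  \sum_(S : {set 'I_n} | (n0 <= #|S|)%N) (x ^+ 2) ^+ #|S|
  <= x ^+ n0 * expR (n%:R * x).
Proof.
move=> x0 x1.
apply: (@le_trans _ _ (x ^+ n0 * \sum_(S : {set 'I_n}) x ^+ #|S|)).
  rewrite mulr_sumr [leLHS]big_mkcond; apply: ler_sum => S _.
  case: ifP => [leS|_]; last by rewrite mulr_ge0 ?exprn_ge0.
  by rewrite -exprM mulnC exprM expr2 ler_wpM2r ?exprn_ge0// ler_wiXn2l.
rewrite ler_wpM2l ?exprn_ge0//.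
have -> : \sum_(S : {set 'I_n}) x ^+ #|S| = (1 + x) ^+ n.
  rewrite -[n in RHS]card_ord -prodr_const addrC bigA_distr.
  apply: eq_bigr => S _; rewrite -prodr_const big_mkcond.
  by apply: eq_bigr => i _.
rewrite expRM_natl lerXn2r ?nnegrE ?expR_ge0 ?expR_ge1Dx//; lra.
Qed.

Variables (theta : dyad n -> R) (rho K : R) (n0 : nat).
Hypothesis theta01 : forall p, 0 <= theta p <= 1.
Hypothesis theta_le : forall p, theta p <= rho.

(** A union bound, in the form of a sum of exponentials, for the event that the
    noise has a mean exceeding [K * rho] over some pair of vertex sets of size
    at least [n0]. *)
Definition excess (A : network n) : R :=
  \sum_(S : {set 'I_n} | (n0 <= #|S|)%N) \sum_(S' : {set 'I_n} | (n0 <= #|S'|)%N)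
    expR (\sum_(p | dyads_between S S' p) noise theta A p
          - K * rho * #|dyads_between S S'|%:R).

Lemma excess_ge0 A : 0 <= excess A.
Proof. by do 2![apply: sumr_ge0 => ? _]; exact: expR_ge0. Qed.

Lemma excess_ge1 (S S' : {set 'I_n}) A :
  (n0 <= #|S|)%N -> (n0 <= #|S'|)%N ->
  K * rho * #|dyads_between S S'|%:R
    <= \sum_(p | dyads_between S S' p) noise theta A p ->
  1 <= excess A.
Proof.
move=> nS nS' big_sum; rewrite /excess (bigD1 S)//= (bigD1 S')//=.
rewrite -addrA; apply: (@le_trans _ _ (expR 0)); first by rewrite expR0.
apply: ler_wpDr; last by rewrite ler_expR subr_ge0.
rewrite addr_ge0//; first by apply: sumr_ge0 => ? _; exact: expR_ge0.
by do 2![apply: sumr_ge0 => ? _]; exact: expR_ge0.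
Qed.

(** There are at least [n0 * (#|S| + #|S'|) / 8] dyads between [S] and [S'], so
    the Chernoff bound splits into one factor for each set. *)
Lemma mean_excess_le (y : R) : (2 <= n0)%N -> 0 <= (K - 2) * rho ->
  8 * y <= (K - 2) * rho * n0%:R ->
  mean theta excess
  <= (\sum_(S : {set 'I_n} | (n0 <= #|S|)%N) expR (- y) ^+ #|S|) ^+ 2.
Proof.
move=> n0_2 Kr y_le; rewrite /excess mean_sum expr2 mulr_suml.
apply: ler_sum => S nS; rewrite mean_sum mulr_sumr.
apply: ler_sum => S' nS'; set D := dyads_between S S'.
pose x p : R := (D p)%:R.
have x2 : \sum_p x p ^+ 2 = #|D|%:R.
  rewrite -sum1_card natr_sum [RHS]big_mkcond/=; apply: eq_bigr => p _.
  by rewrite /x -[p \in D]/(D p); case: (D p) => /=; ring.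
have -> : mean theta (fun A =>
    expR (\sum_(p | D p) noise theta A p - K * rho * #|D|%:R))
  = mean theta (fun A => expR (- (K * rho * #|D|%:R)) *
      expR (\sum_p x p * noise theta A p)).
  apply: eq_mean => A; rewrite -expRD addrC; congr (expR (_ + _)).
  rewrite big_mkcond; apply: eq_bigr => p _.
  by rewrite /x; case: (D p) => /=; rewrite ?mul1r ?mul0r.
rewrite meanZ.
apply: le_trans (ler_wpM2l (expR_ge0 _) (noise_mgf_le theta01 theta_le _)) _.
  by move=> p; rewrite /x; case: (D p) => /=; rewrite ?normr1 ?normr0.
rewrite x2 -expRD -!expRM_natr -expRD ler_expR.
have : 8 * #|D|%:R >= n0%:R * (#|S|%:R + #|S'|%:R) :> R.
  have := card_dyads_between_ge R S (leq_trans n0_2 nS'); rewrite -/D.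
  have [s s'] : (n0%:R <= #|S|%:R :> R) /\ (n0%:R <= #|S'|%:R :> R).
    by rewrite !ler_nat.
  have h1 : (0 : R) <= #|S|%:R * (#|S'|%:R - n0%:R) by rewrite mulr_ge0// subr_ge0.
  have h2 : (0 : R) <= #|S'|%:R * (#|S|%:R - n0%:R) by rewrite mulr_ge0// subr_ge0.
  nra.
move/(ler_wpM2l Kr); have := ler_wpM2r (_ : 0 <= #|S|%:R + #|S'|%:R) y_le.
rewrite addr_ge0// => /(_ isT); lra.
Qed.

End BlockExcess.

(** * Blocks of a label map *)

Section BlockLabels.
Variables (n k : nat).

Definition sort_pair (a b : 'I_k) : 'I_k * 'I_k :=
  if (a <= b)%N then (a, b) else (b, a).

Lemma sort_pairC a b : sort_pair a b = sort_pair b a.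
Proof. by rewrite /sort_pair; case: ltngtP => // /val_inj ->. Qed.

(** The block of a dyad is an unordered pair of classes, encoded by the ordered
    pair, so that the blocks [(a, b)] with [b < a] are empty. *)
Definition block_label (z : {ffun 'I_n -> 'I_k}) (p : dyad n) :=
  sort_pair (z (val p).1) (z (val p).2).

Lemma block_label_eq z (b : 'I_k * 'I_k) p : (b.1 <= b.2)%N ->
  (block_label z p == b)
  = dyads_between [set i | z i == b.1] [set i | z i == b.2] p.
Proof.
case: b => a b /= ab; rewrite /block_label /sort_pair /dyads_between !inE.
set i := z _; set j := z _.
case: leqP => ij; rewrite -pair_eqE /pair_eq/=.
- apply/idP/orP => [->|[//|/andP[/eqP ja /eqP ib]]]; first by left.
  have e : i = j by apply/val_inj/anti_leq; rewrite ij ja ib ab.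
  by rewrite -ja -ib e !eqxx.
- rewrite orbC; apply/idP/orP => [->|[//|/andP[/eqP ia /eqP jb]]]; first by left.
  by move: ij; rewrite ia jb ltnNge ab.
Qed.

Lemma block_label_neq z (b : 'I_k * 'I_k) p :
  (b.2 < b.1)%N -> (block_label z p == b) = false.
Proof.
case: b => a b /= ab; apply/negP => /eqP; rewrite /block_label /sort_pair.
by case: leqP => h [ea eb]; move: ab; rewrite -ea -eb ltnNge ?h// ltnW.
Qed.

Lemma symmetric_block_label (R : realType) (Q : 'M[R]_k)
    (z : {ffun 'I_n -> 'I_k}) (p : dyad n) : Q^T = Q ->
  Q (z (val p).1) (z (val p).2) = Q (block_label z p).1 (block_label z p).2.
Proof.
move=> Qsym; rewrite /block_label /sort_pair.
by case: leqP => //= _; rewrite -[in LHS]Qsym mxE.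
Qed.

End BlockLabels.

(** * Least squares for networks *)

Section NetworkLeastSquares.
Variables (R : realType) (n k n0 : nat).

Lemma ls_criterionE (A : network n) (Q : 'M[R]_k) z : Q^T = Q ->
  ls_criterion A Q z
  = nsq (fun p => (A p)%:R - Q (block_label z p).1 (block_label z p).2).
Proof.
by move=> Qsym; apply: eq_bigr => p _; rewrite (symmetric_block_label _ _ Qsym).
Qed.

(** Any function of the block is induced by a symmetric matrix, so for the
    selected labels the least squares fit is the block average of the data. *)
Lemma ls_minimizer_bavg (A : network n) (Q : 'M[R]_k) z :
  ls_minimizer n0 A Q z ->
  forall p : dyad n, Q (z (val p).1) (z (val p).2)
                     = bavg (block_label z) (fun q => (A q)%:R) p.
Proof.
case=> Qsym zbal Qmin p; rewrite (symmetric_block_label _ _ Qsym).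
set a : dyad n -> R := fun q => (A q)%:R.
pose g b := bsum (block_label z) a b / bsize R (block_label z) b.
pose Q' : 'M[R]_k := \matrix_(i, j) g (sort_pair i j).
have Q'sym : Q'^T = Q' by apply/matrixP => i j; rewrite !mxE sort_pairC.
apply: (bavg_unique (g := fun b => Q b.1 b.2)).
have := Qmin Q' z Q'sym zbal; rewrite ls_criterionE// => /le_trans; apply.
by apply: ler_sum => q _; rewrite mxE.
Qed.

Lemma block_model_sym (Q : 'M[R]_k) (z : {ffun 'I_n -> 'I_k}) :
  Q^T = Q -> (block_model Q z)^T = block_model Q z.
Proof.
by move=> Qsym; apply/matrixP => i j; rewrite !mxE eq_sym -[in LHS]Qsym mxE.
Qed.

Lemma block_model_dyad (Q : 'M[R]_k) (z : {ffun 'I_n -> 'I_k}) (p : dyad n) :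
  block_model Q z (val p).1 (val p).2 = Q (z (val p).1) (z (val p).2).
Proof.
rewrite mxE ifF//; apply/negbTE/eqP => e.
by have := valP p; rewrite /= e ltnn.
Qed.

Lemma frobenius_error_sqr (M N : 'M[R]_n) :
  M^T = M -> N^T = N -> (forall i, M i i = 0) -> (forall i, N i i = 0) ->
  frobenius_norm (M - N) ^+ 2
  = 2 * nsq (fun p : dyad n => M (val p).1 (val p).2 - N (val p).1 (val p).2).
Proof.
move=> Ms Ns M0 N0; rewrite frobenius_norm_sqr.
- by congr (_ * _); apply: eq_bigr => p _; rewrite !mxE.
- by rewrite linearB/= Ms Ns.
- by move=> i; rewrite !mxE M0 N0 subrr.
Qed.

(** Specialization of the oracle inequality: the partitions of the dyads are
    those induced by the label maps, hence [k ^ n] of them with at most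
    [k ^ 2] nonempty blocks each, and every nonempty block of a balanced label
    map consists of the dyads between two large sets of vertices. *)
Lemma network_error_le (Theta0 : 'M[R]_n) (rho K : R)
    (Thetahat : network n -> 'M[R]_n) (Theta : 'M[R]_n)
    (theta := fun p : dyad n => Theta0 (val p).1 (val p).2) :
  (0 < k)%N -> probability_matrix Theta0 -> 0 < rho -> 8 <= K ->
  (forall p, theta p <= rho) ->
  least_squares_estimator k n0 Thetahat -> block_model_class k n0 Theta ->
  network_expectation Theta0 (fun A => frobenius_norm (Thetahat A - Theta0) ^+ 2)
  <= 2 * frobenius_norm (Theta0 - Theta) ^+ 2
     + 2 * (32 * rho * (n%:R * ln k%:R)
       + 3 * (4 * K * rho * (n%:R * ln k%:R + k%:R ^+ 2 * ln (majorant_cst K))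
              + n%:R ^+ 2 * mean theta (excess theta rho K n0))).
Proof.
move=> k0 [Th0sym Th01 Th00] rho0 K8 theta_le lse [z [Q [zbal Qsym ->]]].
have theta01 p : 0 <= theta p <= 1 by exact: Th01.
have /choice[zhat hz] (A : network n) : exists zh : {ffun 'I_n -> 'I_k},
    exists Qhat, ls_minimizer n0 A Qhat zh /\ Thetahat A = block_model Qhat zh.
  by have [Qh [zh h]] := lse A; exists zh, Qh.
pose a (A : network n) (p : dyad n) : R := (A p)%:R.
pose hat A := bavg (block_label (zhat A)) (a A).
have errE A : frobenius_norm (Thetahat A - Theta0) ^+ 2
    = 2 * nsq (fun p => hat A p - theta p).
  have [Qh [hmin ->]] := hz A; have [Qhsym _ _] := hmin.
  rewrite frobenius_error_sqr ?block_model_sym//; last by move=> i; rewrite mxE eqxx.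
  congr (_ * _); apply: eq_bigr => p _.
  by rewrite block_model_dyad (ls_minimizer_bavg hmin).
have ls A : nsq (fun p => a A p - hat A p)
    <= nsq (fun p => a A p - block_model Q z (val p).1 (val p).2).
  have [Qh [hmin _]] := hz A; have [_ _ /(_ Q z Qsym zbal)] := hmin.
  have -> : nsq (fun p => a A p - hat A p) = ls_criterion A Qh (zhat A).
    by apply: eq_bigr => p _; rewrite (ls_minimizer_bavg hmin).
  have -> // : nsq (fun p => a A p - block_model Q z (val p).1 (val p).2)
    = ls_criterion A Q z.
  by apply: eq_bigr => p _; rewrite block_model_dyad.
have U1 A : (forall b, bsum (block_label (zhat A)) (noise theta A) b
      <= K * rho * bsize R (block_label (zhat A)) b) \/
    1 <= excess theta rho K n0 A.
  have [Qh [[_ zhbal _] _]] := hz A.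
  have [|/forallPn[b]] := boolP [forall b, bsum (block_label (zhat A))
      (noise theta A) b <= K * rho * bsize R (block_label (zhat A)) b].
    by move/forallP; left.
  rewrite -ltNge => big_b; right; move: big_b; rewrite /bsum /bsize.
  case: (leqP b.1 b.2) => b12; last first.
    rewrite big_pred0 => [|p]; last exact: block_label_neq.
    by rewrite eq_card0 ?mulr0 ?ltxx// => p; rewrite inE block_label_neq.
  rewrite (eq_bigl _ _ (fun p => block_label_eq _ p b12)).
  rewrite (eq_card (B := dyads_between [set i | zhat A i == b.1]
    [set i | zhat A i == b.2])); last by move=> p; rewrite inE block_label_eq.
  by move/ltW; apply: excess_ge1; rewrite cardsE; exact: zhbal.
have := mean_error_le theta01 theta_le rho0 K8
  (excess_ge0 theta rho K n0) U1 ls.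
have k_gt0 : (0 : R) < k%:R by rewrite ltr0n.
rewrite card_ffun !card_ord card_prod card_ord natrX lnXn// -mulr_natl -natrX -mulnn.
set u := mean theta (excess _ _ _ _).
have u0 : 0 <= u.
  rewrite -(mean_cst theta 0); apply: le_mean => //; exact: excess_ge0.
have Tu : #|{: dyad n}|%:R * u <= n%:R ^+ 2 * u.
  by rewrite ler_wpM2r// -natrX ler_nat card_dyad_le.
have -> : network_expectation Theta0
    (fun A => frobenius_norm (Thetahat A - Theta0) ^+ 2)
    = 2 * mean theta (fun A => nsq (fun p => hat A p - theta p)).
  by rewrite -meanZ; apply: eq_bigr => A _; rewrite errE.
rewrite frobenius_error_sqr ?block_model_sym//; last by move=> i; rewrite mxE eqxx.
rewrite -/theta; lra.
Qed.

End NetworkLeastSquares.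

(** * Risk bound *)

(** With [r = n / k], both [ln n] and [n * x] are at most a multiple of
    [r * ln k], hence of [n0 * ln k / C]; the constant [6 / C] dominates the sum
    of these multiples. *)
Lemma mul_large_sets_bound_le1 (R : realType) (C : R) (n k n0 : nat)
    (x := expR (- ((1 + 6 / C) * ln k%:R))) :
  0 < C -> (2 <= k)%N -> (k <= n)%N -> C * n%:R / k%:R <= n0%:R ->
  n%:R * (x ^+ n0 * expR (n%:R * x)) <= 1.
Proof.
move=> C0 k2 kn n0_ge; set L : R := ln k%:R in x *.
have k_gt0 : (0 : R) < k%:R by rewrite ltr0n; apply: leq_trans k2.
have n_gt0 : (0 : R) < n%:R by rewrite ltr0n; apply: leq_trans kn; apply: leq_trans k2.
have L_half : 2^-1 <= L.
  by apply: le_trans (ln2_ge_half R) _; rewrite ler_ln ?posrE// ler_nat.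
pose r : R := n%:R / k%:R.
have r_gt0 : 0 < r by rewrite divr_gt0.
have r_le : r <= n0%:R / C by rewrite ler_pdivlMr// mulrC mulrA.
have r_ge1 : 1 <= r by rewrite ler_pdivlMr// mul1r ler_nat.
have ln_n : ln n%:R <= r + L.
  have -> : n%:R = r * k%:R by rewrite divfK// gt_eqF.
  by rewrite lnM ?posrE// lerD2r ltW// ln_sublinear.
have nx_le : n%:R * x <= r.
  rewrite /r ler_pM2l// -[k%:R]lnK ?posrE// -expRN ler_expR lerN2 -/L.
  by rewrite ler_peMl//; [lra|rewrite lerDl divr_ge0// ltW].
rewrite -{1}[n%:R]lnK ?posrE// -expRM_natr -!expRD -[leRHS]expR0 ler_expR.
have rL : r <= 2 * (r * L) by nra.
have Lr : L <= r * L by nra.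
have h : 5 * (r * L) <= (1 + 6 / C) * L * n0%:R.
  have : r * L <= n0%:R / C * L by rewrite ler_wpM2r//; lra.
  have : 0 <= n0%:R * L by rewrite mulr_ge0//; lra.
  have : 0 <= n0%:R / C * L by rewrite mulr_ge0 ?divr_ge0 ?(ltW C0)//; lra.
  lra.
rewrite -/L; lra.
Qed.

(* `|Theta0| is the normed-module norm of matrices, i.e. the entrywise
   supremum norm. *)
Theorem corollary2p2 (R : realType) (C : R) (hC : 0 < C) :
  exists C1 C2 : R, [/\ 0 < C1, 0 < C2 &
    forall (n k n0 : nat),
      (2 <= k)%N -> (k <= n)%N -> (2 <= n0)%N -> (n0 <= n)%N ->
      (exists z : {ffun 'I_n -> 'I_k}, balanced n0 z) ->
      C * n%:R / k%:R <= n0%:R ->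
    forall Theta0 : 'M[R]_n,
      probability_matrix Theta0 ->
      k%:R * ln k%:R / n%:R <= `|Theta0| ->
    forall (Thetahat : network n -> 'M[R]_n) (Thetastar : 'M[R]_n),
      least_squares_estimator k n0 Thetahat ->
      best_approximation k n0 Theta0 Thetastar ->
      network_expectation Theta0
        (fun A => n%:R ^- 2 * frobenius_norm (Thetahat A - Theta0) ^+ 2)
      <= C1 / n%:R ^+ 2 * frobenius_norm (Theta0 - Thetastar) ^+ 2
         + C2 * `|Theta0| * (ln k%:R / n%:R + k%:R ^+ 2 / n%:R ^+ 2)].
Proof.
(* [kappa] is the exponent needed in the union bound over vertex sets, and [K]
   is the multiple of [rho] beyond which a block mean is rare enough for it. *)
pose kappa := 1 + 6 / C; pose K := 8 + 16 * kappa / C.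
have kappa_ge0 : 0 <= kappa by rewrite addr_ge0// divr_ge0// ltW.
have K8 : 8 <= K by rewrite lerDl divr_ge0 ?mulr_ge0// ltW.
have lnC0 : 0 <= ln (majorant_cst K) by rewrite ln_ge0// majorant_cst_ge1.
exists 2, (76 + 24 * K + 24 * (K * ln (majorant_cst K))).
have KlnC0 : 0 <= K * ln (majorant_cst K) by rewrite mulr_ge0//; lra.
split; [by []|lra|].
move=> n k n0 k2 kn n0_2 _ _ n0_ge Theta0 prob rho_ge Thetahat Thetastar lse [best _].
set rho := `|Theta0| in rho_ge *.
pose theta (p : dyad n) := Theta0 (val p).1 (val p).2.
have k_gt0 : (0 : R) < k%:R by rewrite ltr0n; apply: leq_trans k2.
have n_gt0 : (0 : R) < n%:R by rewrite ltr0n; apply: leq_trans kn; apply: leq_trans k2.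
have theta01 p : 0 <= theta p <= 1 by have [_ + _] := prob; apply.
have theta_le p : theta p <= rho.
  rewrite (le_trans (ler_norm _))// /rho [leRHS]/Num.Def.normr/= mx_normrE.
  by apply/bigmax_geP; right => /=; exists (val p).
set L := ln k%:R in rho_ge *.
have L_half : 2^-1 <= L.
  by apply: le_trans (ln2_ge_half R) _; rewrite ler_ln ?posrE// ler_nat.
have rho_gt0 : 0 < rho.
  by apply: lt_le_trans rho_ge; rewrite divr_gt0// mulr_gt0//; lra.
have rho_n : k%:R * L <= rho * n%:R by rewrite -ler_pdivrMr.
have := network_error_le (K := K) (ltnW k2) prob rho_gt0 K8 theta_le lse best.
rewrite -/theta -/L; set u := mean theta _.
pose x := expR (- (kappa * L)).
have u_le : n%:R ^+ 2 * u <= 1.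
  (* With means [rho], a vertex has at least [C * L] expected edges into a set of
     [n0] vertices: sparsity and class size compensate each other. *)
  have rho_n0 : C * L <= rho * n0%:R.
    have -> : C * L = (k%:R * L / n%:R) * (C * n%:R / k%:R).
      by field; rewrite !gt_eqF.
    by rewrite ler_pM// ?divr_ge0 ?mulr_ge0//; lra.
  have y_le : 8 * (2 * (kappa * L)) <= (K - 2) * rho * n0%:R.
    have -> : 8 * (2 * (kappa * L)) = (16 * kappa / C) * (C * L).
      by field; rewrite gt_eqF.
    rewrite -[leRHS]mulrA ler_pM ?divr_ge0 ?mulr_ge0//; rewrite /K; lra.
  have := mean_excess_le theta01 theta_le n0_2 _ y_le.
  rewrite mulr_ge0 ?(ltW rho_gt0)//; last by lra.
  move=> /(_ isT) u_le.
  have x_ge0 : 0 <= x by exact: expR_ge0.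
  have x_le1 : x <= 1 by rewrite expR_le1 oppr_le0 mulr_ge0//; lra.
  have := sum_large_sets_le n n0 x_ge0 x_le1.
  rewrite {1}/x -expRM_natl mulrN => s_le.
  have b_le1 := mul_large_sets_bound_le1 hC k2 kn n0_ge.
  rewrite -/L -/kappa -/x in b_le1.
  apply: le_trans (ler_wpM2l (sqr_ge0 _) u_le) _.
  rewrite -exprMn expr_le1//; last first.
    by rewrite mulr_ge0// sumr_ge0// => S _; rewrite exprn_ge0// expR_ge0.
  by apply: le_trans b_le1; rewrite ler_pM2l.
(* The contribution of the rare event is absorbed in the main term. *)
have one_le : 1 <= 2 * (rho * (n%:R * L)).
  have k2' : (2 : R) <= k%:R by rewrite ler_nat.
  have kL : 1 <= k%:R * L by nra.
  have : k%:R * L * L <= rho * n%:R * L by rewrite ler_wpM2r//; lra.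
  nra.
move=> err.
have -> : network_expectation Theta0
    (fun A => n%:R ^- 2 * frobenius_norm (Thetahat A - Theta0) ^+ 2)
  = n%:R ^- 2 * network_expectation Theta0
    (fun A => frobenius_norm (Thetahat A - Theta0) ^+ 2) by exact: (meanZ theta).
apply: le_trans (ler_wpM2l _ err) _; first by rewrite invr_ge0 sqr_ge0.
set F := frobenius_norm _ ^+ 2; set c := ln (majorant_cst K) in lnC0 KlnC0 *.
rewrite [leRHS](_ : _ = n%:R ^- 2 * (2 * F
  + (76 + 24 * K + 24 * (K * c)) * (rho * (n%:R * L) + rho * k%:R ^+ 2)));
  last by field; rewrite gt_eqF.
rewrite ler_pM2l ?invr_gt0 ?exprn_gt0//.
have a0 : 0 <= rho * (n%:R * L) by lra.
have b0 : 0 <= rho * k%:R ^+ 2 by rewrite mulr_ge0 ?sqr_ge0// ltW.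
have : 0 <= K * c * (rho * (n%:R * L)) by rewrite mulr_ge0.
have : 0 <= K * (rho * k%:R ^+ 2) by rewrite mulr_ge0//; lra.
lra.
Qed.
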